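(* For any integer $k\geq 3$, $0<\eta<\tfrac{1}{k}$ and $\alpha>0$ the following holds for all sufficiently large $n\in \mathbb{N}$. There exists an $n$-vertex graph $G$ with $\delta(G)\ge \eta n$ and $\alpha_{k-1}(G)\le \alpha n$ such that every $K_k$-tiling in $G$ covers at most $\eta k n$ vertices.
   Context: Graphs are finite and simple; $\delta(G)$ is the minimum degree and $K_k$ the complete graph on $k$ vertices. For $r\in\mathbb{N}$, $\alpha_r(G)$ is the largest size of a set $U\subset V(G)$ such that $G[U]$ contains no copy of $K_r$. A $K_k$-tiling in $G$ is a collection of vertex-disjoint copies of $K_k$ in $G$. *)

(* Defs.v *)
From HB Require Import structures.
From mathcomp Require Import all_boot all_order all_algebra.
From mathcomp Require Import reals.

Set Implicit Arguments.
Unset Strict Implicit.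
Unset Printing Implicit Defensive.

Record sgraph (V : finType) := SGraph {
  adj :> rel V;
  adj_sym : symmetric adj;
  adj_irrefl : irreflexive adj }.

Section Graph.
Variables (V : finType) (G : sgraph V).

Definition degree (v : V) : nat := #|[set w | G v w]|.

(* The default value #|V| exceeds every degree, so it only matters when V is
   empty. *)
Definition min_degree : nat := \big[minn/#|V|]_(v : V) degree v.

(* A copy of K_r is identified with its vertex set. *)
Definition Kcopy (r : nat) (C : {set V}) : bool :=
  (#|C| == r) && [forall x in C, forall y in C, (x != y) ==> G x y].

Definition Kfree (r : nat) (U : {set V}) : bool :=
  [forall C : {set V}, (C \subset U) ==> ~~ Kcopy r C].

Definition alpha_num (r : nat) : nat :=
  \max_(U : {set V} | Kfree r U) #|U|.

Definition Ktiling (k : nat) (P : {set {set V}}) : bool :=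
  trivIset P && [forall C in P, Kcopy k C].

End Graph.

(* Main.v *)
Require Import Defs.
From mathcomp Require Import all_boot all_order all_algebra.
From mathcomp Require Import zify.
From mathcomp Require Import reals.
Import Order.TTheory GRing.Theory Num.Theory.

(* Write [r = k - 1].  Starting from a path (so that no vertex is isolated),
   repeatedly turn an [r]-set of low-degree vertices, no two of which have a
   common neighbour, into a clique; this keeps the graph [K_k]-free.  Choosing
   the vertices of the clique one by one by averaging, it can be made to lie
   inside a constant proportion of the sets of size at least [n / q] that are
   still [K_r]-free.  After [O(n)] steps no such set is left, while the total
   degree has stayed [O(n)], so that there are always enough low-degree vertices.
   Finally, join a set [A] of [floor (eta n)] vertices to everything: each [K_k]
   must use a vertex of [A], and every other vertex has degree at least
   [#|A| + 1 >= eta n] thanks to its neighbour on the path. *)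

(** * Copies of cliques and their behaviour under adding edges *)

Section Cliques.
Set Implicit Arguments.
Unset Strict Implicit.
Variable V : finType.

Lemma KcopyP (H : sgraph V) r (C : {set V}) :
  reflect (#|C| = r /\ {in C &, forall x y, x != y -> H x y}) (Kcopy H r C).
Proof.
apply: (iffP andP) => [[/eqP cC /forallP HC]|[cC HC]]; split => //.
- move=> x y xC yC; move: (HC x); rewrite xC /= => /forallP/(_ y).
  by rewrite yC /= => /implyP.
- by rewrite cC.
- apply/forallP => x; apply/implyP => xC; apply/forallP => y; apply/implyP => yC.
  by apply/implyP; exact: HC.
Qed.

Lemma Kcopy_subrel (H H' : sgraph V) r (C : {set V}) :
  {in C &, subrel H H'} -> Kcopy H r C -> Kcopy H' r C.
Proof.
move=> sub /KcopyP[cC HC]; apply/KcopyP; split=> // x y xC yC ne.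
by apply: sub => //; exact: HC.
Qed.

Lemma Kfree_subrel (G G' : sgraph V) r (U : {set V}) :
  subrel G G' -> Kfree G' r U -> Kfree G r U.
Proof.
move=> sub /forallP H; apply/forallP => C; apply/implyP => CU.
by have := H C; rewrite CU; apply: contra; apply: Kcopy_subrel => x y _ _; exact: sub.
Qed.

End Cliques.

(** * Turning a vertex set into a clique *)

Section AddClique.
Set Implicit Arguments.
Unset Strict Implicit.
Variables (V : finType) (G : sgraph V).

Definition add_clique_rel (e : {set V}) : rel V :=
  fun x y => (x != y) && (G x y || (x \in e) && (y \in e)).

Lemma add_clique_sym e : symmetric (add_clique_rel e).
Proof. by move=> x y; rewrite /add_clique_rel eq_sym adj_sym andbC (andbC (x \in e)) andbC. Qed.

Lemma add_clique_irrefl e : irreflexive (add_clique_rel e).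
Proof. by move=> x; rewrite /add_clique_rel eqxx. Qed.

Definition add_clique e := SGraph (add_clique_sym e) (add_clique_irrefl e).

Lemma sub_add_clique e : subrel G (add_clique e).
Proof.
move=> x y Gxy /=; rewrite /add_clique_rel Gxy andbT.
by apply: contraTneq Gxy => ->; rewrite adj_irrefl.
Qed.

(* A copy of [K_(r+1)] using a new edge [xy] has a vertex [z] outside [e], and
   then [z] is a common neighbour of [x] and [y] in [G]. *)
Lemma add_clique_Kfree r (e : {set V}) : #|e| <= r ->
  {in e &, forall x y, x != y -> forall z, ~~ (G x z && G z y)} ->
  (forall C, ~~ Kcopy G r.+1 C) -> forall C, ~~ Kcopy (add_clique e) r.+1 C.
Proof.
move=> ce ncn GK C; apply/negP => KC; move: (GK C); apply/negP; rewrite negbK.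
have /KcopyP[cC HC] := KC.
have [z zC ze] : exists2 z, z \in C & z \notin e.
  by apply/subsetPn; apply/negP => /subset_leq_card; lia.
apply/KcopyP; split=> // x y xC yC ne.
have zG w : w \in C -> w \in e -> G w z.
  move=> wC we; have wz : w != z by apply: contraNneq ze => <-.
  by have /= := HC _ _ wC zC wz; rewrite /add_clique_rel (negPf ze) andbF orbF => /andP[].
have /= := HC _ _ xC yC ne; rewrite /add_clique_rel => /andP[_ /orP[//|/andP[xe ye]]].
have := ncn _ _ xe ye ne z; rewrite zG //=.
by rewrite adj_sym zG.
Qed.

Lemma degree_add_clique e v :
  degree (add_clique e) v <= degree G v + (v \in e) * #|e|.
Proof.
rewrite /degree; have [ve|ve] := boolP (v \in e); last first.
  rewrite mul0n addn0; apply: subset_leq_card; apply/subsetP => w.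
  by rewrite !inE /= /add_clique_rel (negPf ve) orbF => /andP[].
rewrite mul1n; apply: leq_trans (leq_card_setU _ _).
apply: subset_leq_card; apply/subsetP => w.
by rewrite !inE /= /add_clique_rel => /andP[_ /orP[->//|/andP[_ ->]]]; rewrite orbT.
Qed.

Lemma sum_degree_add_clique e :
  \sum_v degree (add_clique e) v <= \sum_v degree G v + #|e| * #|e|.
Proof.
apply: (@leq_trans (\sum_v (degree G v + (v \in e) * #|e|))).
  by apply: leq_sum => v _; exact: degree_add_clique.
by rewrite big_split /= -big_distrl /= -big_mkcond sum1_card.
Qed.

(** Only walks of length exactly two count: vertices of the future clique may already be adjacent,
    and what must be avoided is a common neighbour. *)
Definition within2 x := x |: \bigcup_(z | G x z) [set y | G z y].

Lemma within2_sym x y : (x \in within2 y) = (y \in within2 x).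
Proof.
have H a b : a \in within2 b -> b \in within2 a.
  rewrite !inE => /orP[/eqP->|/bigcupP[z Gbz]]; first by rewrite eqxx.
  rewrite inE => Gza; apply/orP; right; apply/bigcupP; exists z; first by rewrite adj_sym.
  by rewrite inE adj_sym.
by apply/idP/idP; apply: H.
Qed.

Lemma card_within2 d x : (forall v, degree G v <= d) -> #|within2 x| <= (d * d).+1.
Proof.
move=> degG; rewrite /within2 cardsU1 -[(d * d).+1]add1n leq_add ?leq_b1 //.
apply: leq_trans (_ : \sum_(z | G x z) degree G z <= _).
  by elim/big_rec2: _ => [|z m A _ IH]; rewrite ?cards0 // (leq_trans (leq_card_setU _ _)) ?leq_add2l.
apply: (@leq_trans (\sum_(z | G x z) d)); first by apply: leq_sum => z _; exact: degG.
rewrite sum_nat_const leq_mul2r; apply/orP; right.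
by apply: leq_trans (degG x); rewrite /degree cardsE.
Qed.

Lemma not_within2_codegree x y : x \notin within2 y -> forall z, ~~ (G x z && G z y).
Proof.
rewrite within2_sym !inE negb_or => /andP[_ /bigcupP nxy] z; apply/negP => /andP[Gxz Gzy].
by apply: nxy; exists z; rewrite ?inE.
Qed.

End AddClique.

(** * Averaging over families of vertex sets *)

Section Averaging.
Set Implicit Arguments.
Unset Strict Implicit.
Variable V : finType.
Implicit Types (F : {set {set V}}) (L e U : {set V}).

(** Double counting of the pairs [(x, U)] with [x] in [U :&: L]: each [U] contributes at least
    [#|V| / c], hence at least [#|L| / c], so some [x] in [L] reaches the average. *)
Lemma popular_vertex F L c : F != set0 -> 0 < #|V| ->
    {in F, forall U, #|V| <= c * #|U :&: L|} ->
  exists2 x, x \in L & #|F| <= c * #|[set U in F | x \in U]|.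
Proof.
move=> /set0Pn[U0 FU0] V0 HF; have [/existsP[x /andP[]]|/existsPn H] :=
  boolP [exists x in L, #|F| <= c * #|[set U in F | x \in U]|]; first by exists x.
(* Nonemptiness of [L] is what makes [lo] and [hi] contradict each other. *)
have L0 : 0 < #|L|.
  have := HF _ FU0; have := subset_leq_card (subsetIr U0 L); case: #|L| => // /[!leqn0] /eqP->.
  by rewrite muln0; lia.
have dc : \sum_(x in L) #|[set U in F | x \in U]| = \sum_(U in F) #|U :&: L|.
  under eq_bigr do rewrite -sum1dep_card big_mkcondr.
  rewrite exchange_big /=; apply: eq_bigr => U _.
  by rewrite -sum1dep_card /= [in RHS]big_mkcondl -big_mkcondr /=; apply: eq_bigl => x; rewrite andbC.
have lo : #|F| * #|L| <= c * \sum_(x in L) #|[set U in F | x \in U]|.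
  rewrite dc big_distrr /= -sum_nat_const; apply: leq_sum => U FU.
  by apply: leq_trans (HF _ FU); rewrite max_card.
have hi : c * \sum_(x in L) #|[set U in F | x \in U]| + #|L| <= #|F| * #|L|.
  rewrite big_distrr /= mulnC -sum_nat_const -[X in _ + X]sum1_card -big_split /=.
  by apply: leq_sum => x Lx; have := H x; rewrite Lx /= -ltnNge addn1.
lia.
Qed.

(** Induction on [r]: restrict [F] to the sets containing the vertices chosen so far, delete their
    [K]-neighbourhoods from [L], and pick a popular vertex. The slack [c * (r * s)] pays for the
    deletions, and each choice costs a factor [c]. *)
Lemma popular_scattered_set (K : V -> {set V}) s L c r F :
    (forall x y, (x \in K y) = (y \in K x)) -> (forall x, x \in K x) ->
    (forall x, #|K x| <= s) -> F != set0 -> 0 < #|V| ->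
    {in F, forall U, #|V| + c * (r * s) <= c * #|U :&: L|} ->
  exists e : {set V}, [/\ e \subset L, #|e| = r,
    {in e &, forall x y, x != y -> x \notin K y} &
    #|F| <= c ^ r * #|[set U in F | e \subset U]|].
Proof.
move=> Ksym Krefl cK F0 V0; elim: r => [|r IH] HF.
  exists set0; split; rewrite ?sub0set ?cards0 //; first by move=> x y; rewrite inE.
  by rewrite expn0 mul1n; apply: subset_leq_card; apply/subsetP => U; rewrite inE sub0set andbT.
have [U /HF|e [eL ce indep Fe]] := IH; first by lia.
set F' := [set U in F | e \subset U] in Fe.
set L' := L :\: \bigcup_(x in e) K x.
have F'0 : F' != set0.
  by apply: contraNneq F0 => F'0; rewrite -cards_eq0; move: Fe; rewrite F'0 cards0; lia.
have cB : #|\bigcup_(x in e) K x| <= r * s.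
  apply: leq_trans (_ : \sum_(x in e) #|K x| <= _).
    by elim/big_rec2: _ => [|z m A _ IH']; rewrite ?cards0 // (leq_trans (leq_card_setU _ _)) ?leq_add2l.
  by rewrite -ce -sum_nat_const; apply: leq_sum => x _; exact: cK.
have [|x xL' Fx] := @popular_vertex F' L' c F'0 V0.
  move=> U; rewrite inE => /andP[FU _].
  have cU : #|U :&: L| <= #|U :&: L'| + r * s.
    rewrite setIDA -(cardsID (\bigcup_(x in e) K x) (U :&: L)) addnC leq_add2l.
    by apply: leq_trans cB; apply: subset_leq_card; exact: subsetIr.
  have := HF _ FU; have : c * #|U :&: L| <= c * (#|U :&: L'| + r * s) by rewrite leq_mul2l cU orbT.
  lia.
move: xL'; rewrite inE => /andP[xB xL].
have xK y : y \in e -> x \notin K y.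
  by move=> ye; apply: contra xB => xKy; apply/bigcupP; exists y.
have xe : x \notin e by apply/negP => /xK; rewrite Krefl.
exists (x |: e); split.
- by rewrite subUset sub1set xL eL.
- by rewrite cardsU1 xe ce.
- move=> y z /setU1P[->|ye] /setU1P[->|ze]; rewrite ?eqxx // => ne; first exact: xK.
  + by rewrite Ksym xK.
  + exact: indep.
- apply: leq_trans Fe _; rewrite expnSr -mulnA leq_mul2l; apply/orP; right.
  apply: leq_trans Fx _; rewrite leq_mul2l; apply/orP; right.
  apply: subset_leq_card; apply/subsetP => U.
  by rewrite !inE subUset sub1set => /andP[/andP[-> ->] ->].
Qed.

End Averaging.

(** * The greedy process and its count of remaining large free sets *)

Section Greedy.
Set Implicit Arguments.
Unset Strict Implicit.
Variables (V : finType) (r q : nat).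
Implicit Types (G : sgraph V) (U : {set V}).

Definition big_Kfree G : {set {set V}} :=
  [set U | Kfree G r U & #|V| <= q * #|U|].

(** Adding edges creates no new free set, and every set containing [e] stops being free. *)
Lemma big_Kfree_add_clique G (e : {set V}) : #|e| = r ->
  #|big_Kfree (add_clique G e)| + #|[set U in big_Kfree G | e \subset U]|
    <= #|big_Kfree G|.
Proof.
move=> ce; rewrite -(cardsID [set U : {set V} | e \subset U] (big_Kfree G)) addnC leq_add //.
  by apply: subset_leq_card; apply/subsetP => U; rewrite !inE.
apply: subset_leq_card; apply/subsetP => U; rewrite !inE => /andP[UK ->].
rewrite (Kfree_subrel (@sub_add_clique _ G e) UK) !andbT.
apply/negP => eU; have /forallP/(_ e) := UK; rewrite eU /= => /negP; apply.
apply/KcopyP; split=> // x y xe ye ne.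
by rewrite /= /add_clique_rel ne xe ye orbT.
Qed.

Lemma card_high_degree G D :
  D * #|[set v | D < degree G v]| <= \sum_v degree G v.
Proof.
rewrite mulnC -sum_nat_const [leqRHS](bigID (mem [set v | D < degree G v])) /=.
by apply: leq_trans (leq_addr _ _); apply: leq_sum => v; rewrite inE => /ltnW.
Qed.

Lemma greedy_step G D s : 0 < q -> 0 < #|V| ->
    (forall C, ~~ Kcopy G r.+1 C) ->
    (forall v, degree G v <= D + r) ->
    4 * q * (\sum_v degree G v) <= D * #|V| ->
    0 < D -> ((D + r) * (D + r)).+1 <= s -> 4 * q * (r * s) <= #|V| ->
  exists G' : sgraph V, [/\ subrel G G', (forall C, ~~ Kcopy G' r.+1 C),
    (forall v, degree G' v <= D + r),
    \sum_v degree G' v <= \sum_v degree G v + r * r &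
    (2 * q) ^ r * #|big_Kfree G'| <= ((2 * q) ^ r).-1 * #|big_Kfree G| ].
Proof.
move=> q0 V0 GK Gdeg Gsum D0 hs hV.
(* If no bad set is left, the graph is kept, so that the process can run for a prescribed number of
   steps. *)
have [F0|F0] := eqVneq (big_Kfree G) set0.
  by exists G; split=> //; rewrite ?leq_addr // F0 cards0 !muln0.
pose L := [set v | degree G v <= D].
have cL : 4 * q * #|~: L| <= #|V|.
  have -> : ~: L = [set v | D < degree G v] by apply/setP => v; rewrite !inE ltnNge.
  have := card_high_degree G D; set h := #|_|; set S := \sum_v _ => hh.
  rewrite -(leq_pmul2l D0); apply: leq_trans Gsum.
  by rewrite mulnCA leq_mul2l hh orbT.
have [] := @popular_scattered_set V (within2 G) s L (2 * q) r (big_Kfree G) => //.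
- by move=> x y; exact: within2_sym.
- by move=> x; rewrite !inE eqxx.
- by move=> x; apply: leq_trans hs; exact: card_within2.
(* With [n = #|V|], [U] has at least [n / q] vertices. Losing [n / (4q)] to high degrees and at most
   [n / (4q)] to [r * s] leaves [n / (2q)], whence [c = 2 * q]. *)
- move=> U; rewrite inE => /andP[_ cU].
  have : #|U| <= #|U :&: L| + #|~: L|.
    rewrite -(cardsID L U) leq_add2l; apply: subset_leq_card.
    by apply/subsetP => x; rewrite !inE => /andP[].
  by move=> h; have := leq_mul (leqnn (4 * q)) h; lia.
move=> e [eL ce indep Fe].
exists (add_clique G e); split.
- exact: sub_add_clique.
- apply: add_clique_Kfree => //; first by rewrite ce.
  by move=> x y xe ye ne; apply: not_within2_codegree; exact: indep.
(* Only vertices of degree at most [D] gain edges, at most [r] each, so the cap [D + r] persists. *)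
- move=> v; apply: leq_trans (degree_add_clique _ _ _) _.
  have [/(subsetP eL)|_] := boolP (v \in e); last by rewrite addn0.
  by rewrite inE ce mul1n leq_add2r.
- by apply: leq_trans (sum_degree_add_clique _ _) _; rewrite ce.
- have := big_Kfree_add_clique G ce; set a := #|_|; set b := #|[set _ in _ | _]|.
  have : 0 < (2 * q) ^ r by rewrite expn_gt0 muln_gt0 q0.
  by case: ((2 * q) ^ r) Fe => // Q /=; rewrite -/b; set c := #|_|; nia.
Qed.


End Greedy.

(** This is [(1 - 1/Q)^Q <= 1/2], from Bernoulli's inequality in the form [bern] with
    [m = Q - 1]. *)
Lemma double_expn_pred Q : 0 < Q -> 2 * Q.-1 ^ Q <= Q ^ Q.
Proof.
case: Q => // m _ /=.
have bern j : m ^ j.+1 + j.+1 * m ^ j <= m.+1 ^ j.+1.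
  elim: j => [|j IH]; first by rewrite !expn1 expn0 mul1n addn1.
  rewrite [m.+1 ^ j.+2]expnS; apply: leq_trans (leq_mul (leqnn m.+1) IH).
  by rewrite [m ^ j.+2]expnS [m ^ j.+1]expnS; nia.
by apply: leq_trans (bern m); rewrite expnS mul2n -addnn; lia.
Qed.

Lemma sparse_Kfree_extension r q d : 0 < q -> exists n0, forall V : finType,
  n0 <= #|V| -> forall G0 : sgraph V,
    (forall C, ~~ Kcopy G0 r.+1 C) -> (forall v, degree G0 v <= d) ->
  exists G : sgraph V, [/\ subrel G0 G, (forall C, ~~ Kcopy G r.+1 C) &
    forall U, Kfree G r U -> q * #|U| < #|V|].
Proof.
(* Each step kills a fraction [1/Q] of the bad sets. [S] bounds the average degree during
   [Q * n.+1 <= 2 * Q * n] steps, each adding at most [r * r] to the degree sum. [D] exceeds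
   [4 * q * S], so at most [n / (4q)] vertices have degree above [D], and exceeds [d] to cover the
   initial degrees. *)
move=> q0; pose Q := (2 * q) ^ r; pose S := d + 2 * Q * (r * r).
pose D := (4 * q * S + d).+1; pose s := ((D + r) * (D + r)).+1.
have Q0 : 0 < Q by rewrite expn_gt0 muln_gt0 q0.
exists (4 * q * (r * s)).+1 => V hV G0 GK0 deg0; set n := #|V| in hV *.
have n0 : 0 < n by lia.
have greedy t : t <= Q * n.+1 -> exists G : sgraph V,
    [/\ subrel G0 G, (forall C, ~~ Kcopy G r.+1 C),
    (forall v, degree G v <= D + r),
    \sum_v degree G v <= d * n + t * (r * r) &
    Q ^ t * #|big_Kfree r q G| <= Q.-1 ^ t * 2 ^ n].
  elim: t => [|t IH] ht.
    exists G0; split=> //.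
    - by move=> v; apply: leq_trans (deg0 v) _; rewrite /D; lia.
    - rewrite mul0n addn0 mulnC -sum_nat_const; apply: leq_sum => v _; exact: deg0.
    - rewrite !mul1n -[n]cardsT -card_powerset; apply: subset_leq_card.
      by apply/subsetP => U _; rewrite inE subsetT.
  have [G [sub GK Gdeg Gsum Gbig]] := IH (ltnW ht).
  have [||||G' [sub' GK' Gdeg' Gsum' Gbig']] := @greedy_step V r q G D s q0 n0 GK Gdeg.
  - rewrite -/n; apply: (@leq_trans (4 * q * (S * n))); last first.
      by rewrite mulnA leq_mul2r /D; apply/orP; right; lia.
    rewrite leq_mul2l; apply/orP; right; apply: leq_trans Gsum _.
    rewrite /S mulnDl leq_add2l mulnAC leq_mul2r; apply/orP; right.
    by apply: leq_trans (ltnW ht) _; nia.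
  - by [].
  - by [].
  - by rewrite -/n; lia.
  exists G'; split=> //.
  - by move=> x y /sub/sub'.
  - by apply: leq_trans Gsum' _; lia.
  - rewrite expnSr expnSr -mulnA; apply: leq_trans (leq_mul (leqnn _) Gbig') _.
    by rewrite mulnCA [X in _ <= X]mulnAC mulnC leq_mul2r Gbig orbT.
(* At most [2^n * (1 - 1/Q)^(Q(n+1)) <= 1/2] bad sets remain, hence none. *)
have [G [sub GK _ _ Gbig]] := greedy _ (leqnn _).
exists G; split=> // U UK; rewrite ltnNge; apply/negP => cU.
have : 0 < #|big_Kfree r q G| by apply/card_gt0P; exists U; rewrite inE UK.
have pow : 2 ^ n.+1 * Q.-1 ^ (Q * n.+1) <= Q ^ (Q * n.+1).
  by rewrite !expnM -expnMn leq_exp2r // double_expn_pred.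
have Qt : 0 < Q ^ (Q * n.+1) by rewrite expn_gt0 Q0.
have p2 : 0 < 2 ^ n by rewrite expn_gt0.
move: pow Gbig Qt p2; rewrite expnS; set A := Q ^ _; set B := Q.-1 ^ _.
set T := 2 ^ n; set b := #|_| => pow Gbig A0 T0 b0; nia.
Qed.

(** * The path as initial graph *)

Section Path.
Variable n : nat.

Definition path_rel : rel 'I_n := fun x y => (x.+1 == y) || (y.+1 == x).

Lemma path_sym : symmetric path_rel.
Proof. by move=> x y; rewrite /path_rel orbC. Qed.

Lemma path_irrefl : irreflexive path_rel.
Proof. by move=> x; rewrite /path_rel; lia. Qed.

Definition path_graph := SGraph path_sym path_irrefl.

Lemma degree_path_graph v : degree path_graph v <= 2.
Proof.
rewrite /degree.
rewrite (_ : [set w | _] = [set w : 'I_n | v.+1 == w] :|: [set w : 'I_n | w.+1 == v]).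
  apply: leq_trans (leq_card_setU _ _) _; rewrite -[2]/(1 + 1) leq_add //.
    by apply/card_le1_eqP => x y; rewrite !inE => /eqP hx /eqP hy; apply: val_inj; rewrite /= -hx.
  by apply/card_le1_eqP => x y; rewrite !inE => /eqP hx /eqP hy; apply: val_inj => /=; lia.
by apply/setP => w; rewrite !inE.
Qed.

Lemma path_graph_Kfree k C : 3 <= k -> ~~ Kcopy path_graph k C.
Proof.
move=> k3; apply/negP => /KcopyP[cC HC].
have /card_gt2P[x [y [z [[xC yC zC] [xy yz zx]]]]] : 2 < #|C| by rewrite cC.
have := HC _ _ xC yC xy; have := HC _ _ yC zC yz; have := HC _ _ zC xC zx.
by rewrite /= /path_rel; lia.
Qed.

End Path.

(** * Joining a hub to all vertices *)

Section Hub.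
Set Implicit Arguments.
Unset Strict Implicit.
Variables (V : finType) (A : {set V}) (H : sgraph V).

Definition hub_rel : rel V :=
  fun x y => (x != y) && [|| x \in A, y \in A | H x y].

Lemma hub_sym : symmetric hub_rel.
Proof. by move=> x y; rewrite /hub_rel eq_sym adj_sym orbCA. Qed.

Lemma hub_irrefl : irreflexive hub_rel.
Proof. by move=> x; rewrite /hub_rel eqxx. Qed.

Definition hub_graph := SGraph hub_sym hub_irrefl.

Lemma sub_hub_graph : subrel H hub_graph.
Proof.
move=> x y Hxy /=; rewrite /hub_rel Hxy !orbT andbT.
by apply: contraTneq Hxy => ->; rewrite adj_irrefl.
Qed.

Lemma min_degree_hub m : m <= #|V| -> m <= #|V|.-1 -> m <= #|A|.+1 ->
    {in ~: A, forall x, exists2 y, y \in ~: A & H x y} ->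
  m <= min_degree hub_graph.
Proof.
move=> mV mV1 mA HA; rewrite /min_degree.
(* The base case is the default value [#|V|] of [min_degree], covered by the first hypothesis on
   [m]. *)
elim/big_rec: _ => // v d _ md; rewrite leq_min md andbT /degree.
have [vA|vA] := boolP (v \in A).
  apply: leq_trans mV1 _; rewrite -(cardC1 v); apply: subset_leq_card.
  by apply/subsetP => w; rewrite !inE /= /hub_rel vA andbT eq_sym.
have [|y yA Hvy] := HA v; first by rewrite inE.
apply: leq_trans mA _; have <- : #|y |: A| = #|A|.+1 by rewrite cardsU1; move: yA; rewrite inE => ->.
apply: subset_leq_card; apply/subsetP => w /setU1P[->|wA]; rewrite inE.
  exact: sub_hub_graph.
rewrite /= /hub_rel wA orbT andbT.
by apply: contraNneq vA => ->.
Qed.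

(* Every copy of [K_k] meets the hub, so disjoint copies inject into [A]. *)
Lemma card_cover_hub k P : (forall C, ~~ Kcopy H k C) ->
  Ktiling hub_graph k P -> #|cover P| <= k * #|A|.
Proof.
move=> HK /andP[tP /forallP KP].
have {}KP C : C \in P -> Kcopy hub_graph k C by move=> CP; have := KP C; rewrite CP.
have meet C : C \in P -> 1 <= #|C :&: A|.
  move=> CP; rewrite lt0n cards_eq0; apply: contra (HK C) => /eqP CA.
  apply: Kcopy_subrel (KP _ CP) => x y xC yC /andP[_].
  have notA z : z \in C -> z \in A = false.
    by move=> zC; apply/negP => zA; have := in_set0 z; rewrite -CA inE zC zA.
  by rewrite !notA.
have PA : #|P| <= #|A|.
  rewrite -sum1_card; apply: (@leq_trans (\sum_(C in P) #|C :&: A|)); first exact: leq_sum.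
  have -> : \sum_(C in P) #|C :&: A| = \sum_(x in cover P | x \in A) 1.
    rewrite big_trivIset_cond //=; apply: eq_bigr => C _.
    by rewrite -sum1_card; apply: eq_bigl => x; rewrite inE.
  by rewrite sum1_card; apply: subset_leq_card; apply/subsetP => x /andP[].
rewrite -sum1_card big_trivIset //=.
rewrite (eq_bigr (fun=> k)); last by move=> C /KP/KcopyP[cC _]; rewrite sum1_card.
by rewrite sum_nat_const mulnC leq_mul2l PA orbT.
Qed.

End Hub.

(** * Choice of parameters and assembly of the graph *)

Local Open Scope ring_scope.

Theorem proposition1p6 (R : realType) (k : nat) (eta alpha : R)
    (hk : (3 <= k)%N) (heta0 : 0 < eta) (heta1 : eta < 1 / k%:R)
    (halpha : 0 < alpha) :
  exists n0 : nat, forall n : nat, (n0 <= n)%N ->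
    exists G : sgraph 'I_n,
      [/\ eta * n%:R <= (min_degree G)%:R,
          (alpha_num G (k - 1))%:R <= alpha * n%:R &
          forall P : {set {set 'I_n}}, Ktiling G k P ->
            #|cover P|%:R <= eta * k%:R * n%:R].
Proof.
have k0 : 0 < k%:R :> R by rewrite ltr0n; lia.
pose q := (Num.trunc alpha^-1).+1.
have hq : 1 < alpha * q%:R.
  have /andP[_] := truncn_itv (ltW (etrans (invr_gt0 alpha) halpha)).
  by rewrite -/q invf_plt ?posrE ?ltr0n // => h; rewrite -ltr_pdivrMr ?ltr0n // div1r.
have [n0 Hn0] := @sparse_Kfree_extension (k - 1) q 2 isT.
exists (n0 + 6)%N => n hn.
have kE : ((k - 1).+1 = k)%N by lia.
have [||C|H [sub HK HU]] := Hn0 'I_n _ (path_graph n).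
- by rewrite card_ord; lia.
- by move=> C; rewrite kE; exact: path_graph_Kfree.
- exact: degree_path_graph.
rewrite kE card_ord in HK HU.
pose a := Num.trunc (eta * n%:R).
have /andP[a_le lt_a] : a%:R <= eta * n%:R < a.+1%:R.
  by apply: truncn_itv; apply: mulr_ge0; [exact: ltW | exact: ler0n].
have a_n : (k * a < n)%N.
  rewrite -(ltr_nat R) natrM; apply: le_lt_trans (ler_wpM2l (ltW k0) a_le) _.
  have n_gt0 : 0 < n%:R :> R by rewrite ltr0n; lia.
  by rewrite mulrA -[ltRHS]mul1r ltr_pM2r // mulrC -ltr_pdivlMr.
(* As [A] is an initial segment, the vertices outside it still form a path; the next bound on [a]
   gives it at least two vertices. *)
pose A := [set x : 'I_n | (x < a)%N].
have a3 : (3 * a < n)%N by apply: leq_ltn_trans a_n; rewrite leq_mul2r hk orbT.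
have cA : #|A| = a.
  have an : (a <= n)%N by lia.
  rewrite (_ : A = [set widen_ord an i | i : 'I_a]) ?card_imset ?cardsT ?card_ord //.
    by move=> i j /(congr1 val) /= /val_inj.
  apply/setP => x; rewrite inE; apply/idP/imsetP => [xa|[i _ ->]]; last exact: (ltn_ord i).
  by exists (Ordinal xa) => //; apply: val_inj.
exists (hub_graph A H); split.
- apply: le_trans (ltW lt_a) _; rewrite ler_nat.
  apply: min_degree_hub; rewrite ?card_ord ?cA; [lia|lia|lia|].
  move=> x; rewrite !inE -leqNgt => ax.
  have adj_path (y : 'I_n) : path_graph n x y -> (a <= y)%N ->
      exists2 y, y \in ~: A & H x y.
    by move=> xy ay; exists y; [rewrite !inE -leqNgt | exact: sub].
  (* The first vertex outside [A] must use its successor; the others use their predecessor. *)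
  have [xa|xa] := eqVneq (nat_of_ord x) a.
    have a1n : (a.+1 < n)%N by lia.
    by apply: (adj_path (Ordinal a1n)); rewrite /= ?/path_rel /=; lia.
  have x1n : (x.-1 < n)%N by have := ltn_ord x; lia.
  by apply: (adj_path (Ordinal x1n)); rewrite /= ?/path_rel /=; lia.
- have n_alpha : 0 <= alpha * n%:R by apply: mulr_ge0; [exact: ltW | exact: ler0n].
  (* Passing to the integer part lets the maximum be bounded set by set. A set free in the hub graph
     is free in [H], so [q * #|U| < n], and [1 < alpha * q] concludes. *)
  rewrite -truncn_ge_nat //; apply/bigmax_leqP => U UK; rewrite truncn_ge_nat //.
  have := HU _ (Kfree_subrel (@sub_hub_graph _ A H) UK).
  rewrite -(ltr_nat R) natrM -(ltr_pM2l halpha) mulrA => /ltW; apply: le_trans.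
  by rewrite ler_peMl ?ler0n // ltW.
- move=> P tP; apply: (@le_trans _ _ (k * a)%:R).
    by rewrite ler_nat -[X in (k * X)%N]cA; exact: card_cover_hub tP.
  by rewrite natrM mulrAC mulrC ler_wpM2r ?ler0n.
Qed.
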